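(* Let $G$ and $H$ be arbitrary connected non-trivial graphs where $H$ is not a complete graph and $G$ is not isomorphic to $K_2$. Suppose that the following conditions are satisfied: (1) $tn(G)=2=|Ext(G)|$ with $Ext(G)=\{u,v\}$; (2) $tn(H)>2$; (3) $N_G(x)\cup N_G(y)\neq V(G)$ for any $x,y\in V(G)$; (4) $d_G(u,v)\geq 3$ and, if $d_G(u,v)=3$, then for all adjacent vertices $u',v'$ of $G$ with $u'\in N_G(u)$ and $v'\in N_G(v)$ the following holds: for every $z\in N_G(u')\cup N_G(v')$ there exists $x\notin N_G(u')\cup N_G(v')$ (with $x\in V(G)$) such that $x\notin T_G(u',z)\cup T_G(v',z)$. Then $tn(G\circ H)=3\cdot tn(G)$.
   Context: All graphs are finite, undirected, without loops or multiple edges; a graph is non-trivial if it has at least two vertices. $N_F(x)$ is the open neighborhood of $x$ in $F$ and $d_F$ is the shortest-path distance. The lexicographic product $G\circ H$ has vertex set $V(G)\times V(H)$, and $(g_1,h_1)$, $(g_2,h_2)$ are adjacent if either $g_1g_2\in E(G)$ or ($g_1=g_2$ and $h_1h_2\in E(H)$). For distinct non-adjacent vertices $u,v$ of a graph $F$, a tolled walk between $u$ and $v$ is a sequence of vertices $u,w_1,\ldots,w_k,v$ with $k\ge 1$ such that $w_iw_{i+1}\in E(F)$ for all $1\le i<k$, $uw_i\in E(F)$ if and only if $i=1$, and $vw_i\in E(F)$ if and only if $i=k$. If $uv\in E(F)$, the only tolled walk between $u$ and $v$ is $u,v$; the only tolled walk from $v$ to $v$ is $v$ itself. The toll interval $T_F(u,v)$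 is the set of all vertices lying on some tolled walk between $u$ and $v$. A set $S\subseteq V(F)$ is t-convex if $T_F(u,v)\subseteq S$ for all $u,v\in S$. A vertex $s$ is an extreme vertex of $F$ if $V(F)-\{s\}$ is t-convex; $Ext(F)$ is the set of extreme vertices of $F$. A set $S\subseteq V(F)$ is a toll set of $F$ if $\bigcup_{u,v\in S}T_F(u,v)=V(F)$. The toll number $tn(F)$ is the minimum size of a toll set of $F$. *)

(* Defs.v *)
From HB Require Import structures.
From mathcomp Require Import all_boot.
From mathcomp.classical Require Import boolp.

Set Implicit Arguments.
Unset Strict Implicit.
Unset Printing Implicit Defensive.

Record sgraph := SGraph {
  svertex :> finType;
  sedge : rel svertex;
  sedge_sym : symmetric sedge;
  sedge_irrefl : irreflexive sedge }.

Notation "x -- y" := (sedge x y) (at level 30).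

Definition nontrivial (F : sgraph) : bool := 1 < #|F|.

Definition connected (F : sgraph) : Prop :=
  forall x y : F, connect (@sedge F) x y.

Definition complete (F : sgraph) : Prop :=
  forall x y : F, x != y -> x -- y.

Definition isomorphic (F1 F2 : sgraph) : Prop :=
  exists f : F1 -> F2, bijective f /\ forall x y, (f x -- f y) = (x -- y).

Lemma neq_sym (T : eqType) : symmetric (fun x y : T => x != y).
Proof. by move=> x y; rewrite eq_sym. Qed.

Lemma neq_irrefl (T : eqType) : irreflexive (fun x y : T => x != y).
Proof. by move=> x; rewrite eqxx. Qed.

Definition K (n : nat) : sgraph :=
  SGraph (@neq_sym 'I_n) (@neq_irrefl 'I_n).

Section Lexicographic.
Variables G H : sgraph.

Definition lex_rel : rel (G * H)%type :=
  fun p q => (p.1 -- q.1) || ((p.1 == q.1) && (p.2 -- q.2)).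

Lemma lex_sym : symmetric lex_rel.
Proof.
by move=> p q; rewrite /lex_rel sedge_sym eq_sym [p.2 -- _]sedge_sym.
Qed.

Lemma lex_irrefl : irreflexive lex_rel.
Proof. by move=> p; rewrite /lex_rel !sedge_irrefl andbF. Qed.

Definition lexprod : sgraph := SGraph lex_sym lex_irrefl.
End Lexicographic.

Section Toll.
Variable F : sgraph.
Implicit Types (u v x y : F) (S : {set F}).

Definition nbhd x : {set F} := [set y | x -- y].

(* The search stops at #|F|, which is then the value for pairs of vertices in
   different components; see gdistP for connected ones. *)
Definition gdist u v : nat :=
  find (fun n => [exists p : n.-tuple F, path (@sedge F) u p && (last u p == v)])
       (iota 0 #|F|).

Lemma gdist_le u p : path (@sedge F) u p -> gdist u (last u p) <= size p.
Proof.
move=> up; rewrite leqNgt; apply/negP => lt_p.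
have lt_pF : size p < #|F|.
  by apply: leq_trans lt_p _; rewrite -[leqRHS](size_iota 0) find_size.
have := before_find 0 lt_p; rewrite nth_iota // add0n => /negbT/existsP[].
by exists (in_tuple p); rewrite up eqxx.
Qed.

Lemma gdistP u v : connect (@sedge F) u v ->
  (exists p, [/\ path (@sedge F) u p, last u p = v & size p = gdist u v]) /\
  (forall p, path (@sedge F) u p -> last u p = v -> gdist u v <= size p).
Proof.
move=> cuv; split=> [|p up <-]; last exact: gdist_le.
case/connectP: cuv => p up ->{v}; case/shortenP: up => q uq Uq _.
have lt_q : size q < #|F| by have := card_uniqP Uq => /= <-; exact: max_card.
have lt_d : gdist u (last u q) < #|F| by exact: leq_ltn_trans (gdist_le uq) _.
have := lt_d; rewrite -[X in _ < X](size_iota 0) -has_find => /(nth_find 0).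
rewrite -/(gdist u (last u q)) nth_iota // add0n => /existsP[r /andP[ur /eqP lr]].
by exists r; rewrite size_tuple.
Qed.

(* s is the list of all vertices of the walk, including both ends.  The inner
   vertices w are indexed from 0, so that w_1 and w_k are the entries of index
   0 and (size w).-1. *)
Definition tolled_walk u v (s : seq F) : Prop :=
  if u == v then s = [:: v]
  else if u -- v then s = [:: u; v]
  else exists w : seq F,
    [/\ s = u :: rcons w v, 0 < size w,
        forall i, i.+1 < size w -> nth u w i -- nth u w i.+1,
        forall i, i < size w -> (u -- nth u w i) = (i == 0) &
        forall i, i < size w -> (v -- nth u w i) = (i == (size w).-1)].

Definition toll_interval u v : {set F} :=
  [set x | `[< exists s, tolled_walk u v s /\ x \in s >]].

Definition t_convex S : Prop :=
  forall u v, u \in S -> v \in S -> toll_interval u v \subset S.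

Definition extreme_vertices : {set F} := [set s | `[< t_convex (~: [set s]) >]].

Definition toll_set S : bool :=
  \bigcup_(u in S) \bigcup_(v in S) toll_interval u v == [set: F].

Lemma toll_setT : toll_set [set: F].
Proof.
apply/eqP/setP=> x; rewrite inE; apply/bigcupP; exists x; first by rewrite inE.
apply/bigcupP; exists x; first by rewrite inE.
rewrite inE; apply/asboolP; exists [:: x].
by rewrite /tolled_walk eqxx inE.
Qed.

(* By toll_setT the arg min is taken over a nonempty family. *)
Definition toll_number : nat := #|[arg min_(S < [set: F] | toll_set S) #|S|]|.
End Toll.

(* Main.v *)
Require Import Defs.
From HB Require Import structures.
From mathcomp Require Import all_boot.
From mathcomp.classical Require Import boolp.
From mathcomp Require Import zify.

(** Write N(g) for the set of neighbours of g, N[g] for N(g) together with g, and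
call {g} x H the layer of g in the product L of G and H.

Six vertices suffice.  Since an extreme vertex belongs to every toll set, the
toll set of size 2 of G is {u, v}, and a tolled walk from u to v lifts to L
with an arbitrary constant second coordinate; so one vertex in the layer of u
and one in the layer of v already cover all the other layers.  Two vertices
with non-adjacent second coordinates in the layer of a neighbour u' of u cover
the whole layer of u, and a neighbour v' of v serves v in the same way
([lex_toll_set6]).

Fewer do not.  A tolled walk of L between two different layers that enters the
layer of an end can never leave it again, hence it projects to a tolled walk
of G; between two vertices of one layer it is either a tolled walk of H or
has a single inner vertex, in a neighbouring layer.  So if S is a toll set of
L and f(g) is the number of vertices of S in the layer of g, then for every g
either the fiber of S over g is a toll set of H, whence f(g) > 2, or some
neighbour of g has weight at least 2, or g is strictly inside the toll interval
of two non-adjacent vertices of positive weight ([toll_set_layer]).  What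
remains concerns only G and the weight f ([dominating_weight]).  The third
alternative is excluded at the extreme vertices u and v, so N[u] and N[v] have
weight at least 2 each; they are disjoint because the distance is at least 3.
If the total were at most 5, the only tight situations would be the following.
 - All the weight sits in a neighbour x of one end and in the other end: then
   x itself is not dominated.
 - Neighbours x of u and x' of v have weight at least 2 each, and at most one
   further vertex p has positive weight, which is then 1.  If x and x' are not
   adjacent, a weight 3 in one of them leaves the other undominated; otherwise
   x has to lie in the toll interval of p and x', and x' in that of p and x,
   so that x, p, x' are pairwise non-adjacent; but then the walk through x can make the detour
   x, u, x, against the extremality of u ([extreme_nbr_interval]).  If they are
   adjacent, the distance is 3; every vertex outside N(x) and N(x') differs
   from p and lies in the toll interval of p and x or x', so p itself is in
   N(x) or N(x'), which contradicts the hypothesis on distance 3.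

All computations with tolled walks go through one reformulation
([toll_interval_intro], [toll_interval_elim]): an inner vertex x lies in the
toll interval of non-adjacent u and v iff v can be reached from x without
stepping into N(u), and u without stepping into N(v). *)

Set Implicit Arguments.
Unset Strict Implicit.
Unset Printing Implicit Defensive.

(** * Toll intervals through reachability *)

Section TollIntervals.
Variable F : sgraph.
Implicit Types (a b c u v w x y : F) (S : {set F}).

Lemma sedge_neq x y : x -- y -> x != y.
Proof. by apply: contraTneq => ->; rewrite sedge_irrefl. Qed.

(** Only the target of a step is constrained, so that a vertex x of N(c) may
start a path, as the first inner vertex of a tolled walk has to. *)
Definition avoid c : rel F := fun a b => (a -- b) && ~~ (c -- b).

Lemma avoid_sedge c a b : avoid c a b -> a -- b.
Proof. by case/andP. Qed.

Lemma path_avoid c x q : path (avoid c) x q -> all (fun a => ~~ (c -- a)) q.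
Proof. by elim: q x => //= y q IHq x /andP[/andP[_ ->] /IHq]. Qed.

(** A tolled walk meets N(c) only once; cutting a path at its first vertex in
N(c) gives that. *)
Lemma path_until_nbr c (e : rel F) x :
  (forall a b, e a b -> a -- b) -> x != c -> connect e x c ->
  exists q, [/\ path e x q, c -- last x q &
                all (fun a => ~~ (c -- a)) (belast x q)].
Proof.
move=> eE + /connectP[p]; elim: p x => [|y p IHp] x /=.
  by move=> /[swap] _ /[swap] ->; rewrite eqxx.
move=> xc /andP[exy yp] lp; case: (boolP (c -- x)) => cx; first by exists [::].
have yc : y != c by apply: contraNneq cx => <-; rewrite sedge_sym eE.
have [q [yq lq aq]] := IHp _ yc yp lp.
by exists (y :: q); rewrite /= exy cx.
Qed.

(** Cut the path from x to v at the first neighbour of v, and the path from x to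
u at the first neighbour of u; the reverse of the second followed by the first
is a tolled walk, even when x itself is adjacent to u or v. *)
Lemma toll_interval_intro u v x :
  u != v -> ~~ (u -- v) -> x != u -> x != v ->
  connect (avoid u) x v -> connect (avoid v) x u -> x \in toll_interval u v.
Proof.
move=> uv uNv xu xv cv cu.
have [q [xq lq aq]] := path_until_nbr (@avoid_sedge u) xv cv.
have [r [xr lr ar]] := path_until_nbr (@avoid_sedge v) xu cu.
have qu := path_avoid xq; have rv := path_avoid xr.
rewrite inE; apply/asboolP.
(* The two factorisations of the walk expose its first and its last inner
   vertex. *)
pose w := rev (x :: r) ++ q.
have wl : w = last x r :: (rev (belast x r) ++ q) by rewrite /w lastI rev_rcons.
have wr : w = rcons (rev r ++ belast x q) (last x q).
  by rewrite /w rcons_cat -lastI rev_cons cat_rcons.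
exists (u :: rcons w v); split; last first.
  by rewrite inE mem_rcons inE /w mem_cat mem_rev mem_head !orbT.
rewrite /tolled_walk (negPf uv) (negPf uNv); exists w; split=> //.
- by rewrite wl.
- move=> i iw; rewrite !(set_nth_default x u) ?(ltnW iw) //.
  suff /(sortedP x) sw : sorted (@sedge F) w by exact: sw.
  rewrite wl /= cat_path; apply/andP; split.
    rewrite rev_path; apply: sub_path xr => a b /avoid_sedge.
    by rewrite sedge_sym.
  have -> : last (last x r) (rev (belast x r)) = x.
    rewrite -(last_cons u) -rev_rcons -lastI rev_cons last_rcons //.
  exact: sub_path (@avoid_sedge u) _ _ xq.
- case=> [|i]; rewrite wl ?lr //= ltnS => iw.
  apply/negbTE; move: i iw; apply/(all_nthP u (a := fun a => ~~ (u -- a))).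
  by rewrite all_cat all_rev ar.
- move=> i; rewrite wr size_rcons ltnS leq_eqVlt => /orP[/eqP->|iw].
    by rewrite nth_rcons ltnn !eqxx lq.
  rewrite nth_rcons iw (ltn_eqF iw); apply/negbTE; move: i iw.
  apply/(all_nthP u (a := fun a => ~~ (v -- a))).
  by rewrite all_cat all_rev rv.
Qed.

Lemma toll_interval_elim u v x : x \in toll_interval u v ->
  [\/ x = u, x = v |
   [/\ u != v, ~~ (u -- v), connect (avoid u) x v & connect (avoid v) x u]].
Proof.
rewrite inE => /asboolP[s [+ xs]]; rewrite /tolled_walk.
case: (eqVneq u v) => [_|uv].
  by move=> sE; move: xs; rewrite sE inE => /eqP; constructor 2.
case: (boolP (u -- v)) => [_|uNv].
  by move=> sE; move: xs; rewrite sE !inE => /orP[]/eqP;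
    [constructor 1 | constructor 2].
case=> w [sE w0 wE wu wv]; move: xs.
rewrite sE inE mem_rcons inE => /or3P[/eqP|/eqP|xw]; [by constructor 1|by constructor 2|].
constructor 3; split=> //; rewrite -(nth_index u xw).
- move: xw; rewrite -index_mem; set i := index x w => iw.
  have [n] := ubnP (size w - i).
  elim: n i iw => // n IHn i iw ni.
  have [iw'|] := ltnP i.+1 (size w).
    apply: connect_trans (connect1 _) (IHn _ iw' _); last by lia.
    by rewrite /avoid wE // wu.
  move=> iw'; apply: connect1; rewrite /avoid uNv andbT sedge_sym wv //.
  by rewrite -eqSS prednK // eqn_leq iw iw'.
- move: xw; rewrite -index_mem; elim: (index x w) => [_|i IHi iw].
    by apply: connect1; rewrite /avoid sedge_sym wu // eqxx sedge_sym uNv.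
  apply: connect_trans (connect1 _) (IHi (ltnW iw)).
  rewrite /avoid sedge_sym wE // wv ?(ltnW iw) //.
  by rewrite -eqSS prednK // neq_ltn iw.
Qed.

(** For inner vertices the characterisation by reachability is symmetric. *)
Lemma toll_interval_sym u v x : x != u -> x != v ->
  x \in toll_interval u v -> x \in toll_interval v u.
Proof.
move=> xu xv /toll_interval_elim[xE|xE|[uv uNv cv cu]].
- by rewrite xE eqxx in xu.
- by rewrite xE eqxx in xv.
- by apply: toll_interval_intro; rewrite // 1?eq_sym 1?sedge_sym.
Qed.

Lemma toll_interval_refl u : u \in toll_interval u u.
Proof.
by rewrite inE; apply/asboolP; exists [:: u]; rewrite /tolled_walk eqxx inE.
Qed.

Lemma toll_setP S :
  reflect (forall x, exists a b, [/\ a \in S, b \in S & x \in toll_interval a b])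
          (toll_set S).
Proof.
apply: (iffP eqP) => [SE x|cov].
  have := in_setT x; rewrite -SE => /bigcupP[a aS /bigcupP[b bS xab]].
  by exists a, b.
apply/setP=> x; rewrite inE; have [a [b [aS bS xab]]] := cov x.
by apply/bigcupP; exists a => //; apply/bigcupP; exists b.
Qed.

Lemma toll_number_le S : toll_set S -> toll_number F <= #|S|.
Proof.
by rewrite /toll_number; case: arg_minnP => [|T _ minT /minT]; first exact: toll_setT.
Qed.

Lemma toll_number_attained : exists S, toll_set S /\ #|S| = toll_number F.
Proof.
by rewrite /toll_number; case: arg_minnP => [|T ? _]; [exact: toll_setT | exists T].
Qed.

Lemma extremeP s a b : s \in extreme_vertices F -> a != s -> b != s ->
  s \notin toll_interval a b.
Proof.
rewrite inE => /asboolP conv sa sb; apply/negP => sab.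
have aC : a \in ~: [set s] by rewrite !inE.
have bC : b \in ~: [set s] by rewrite !inE.
by have := subsetP (conv a b aC bC) s sab; rewrite !inE eqxx.
Qed.

Lemma extreme_mem_toll_set s S :
  s \in extreme_vertices F -> toll_set S -> s \in S.
Proof.
move=> sE /toll_setP/(_ s)[a [b [aS bS]]]; apply: contraTT => sS.
by apply: extremeP => //; apply: contraNneq sS => <-.
Qed.

(** If a and b were not adjacent, a, s, b would be a tolled walk. *)
Lemma extreme_simplicial s a b : s \in extreme_vertices F ->
  s -- a -> s -- b -> a != b -> a -- b.
Proof.
move=> sE sa sb ab; apply: contraT => aNb.
have as_ : a != s by rewrite eq_sym sedge_neq.
have bs : b != s by rewrite eq_sym sedge_neq.
have /negP[] := extremeP sE as_ bs.
apply: toll_interval_intro; rewrite // 1?eq_sym //; apply: connect1.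
  by rewrite /avoid sb.
by rewrite /avoid sa sedge_sym.
Qed.

(** A walk through x may be extended by the detour x, s, x: it stays tolled
because s cannot be adjacent to p or q, as N(s) is a clique that contains x. *)
Lemma extreme_nbr_interval s x p q : s \in extreme_vertices F -> s -- x ->
  ~~ (x -- p) -> x != p -> ~~ (x -- q) -> x != q ->
  x \notin toll_interval p q.
Proof.
move=> sE sx xNp xp xNq xq; apply/negP.
case/toll_interval_elim => [xE|xE|[pq pNq cq cp]].
- by rewrite xE eqxx in xp.
- by rewrite xE eqxx in xq.
have away r : ~~ (x -- r) -> r != s.
  by apply: contraNneq => ->; rewrite sedge_sym.
have ps := away _ xNp; have qs := away _ xNq.
have /negP[] := extremeP sE ps qs.
apply: toll_interval_intro; rewrite // 1?eq_sym //.
  apply: connect_trans (connect1 _) cq.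
  by rewrite /avoid sx sedge_sym.
apply: connect_trans (connect1 _) cp.
by rewrite /avoid sx sedge_sym.
Qed.
End TollIntervals.

(** * Toll intervals of a lexicographic product *)

Section LexIntervals.
Variables G H : sgraph.
Implicit Types (a b t : lexprod G H).

Lemma lexE a b : a -- b = (a.1 -- b.1) || ((a.1 == b.1) && (a.2 -- b.2)).
Proof. by []. Qed.

Lemma lex_interval_lift (u v x : G) (h1 h2 h : H) : x != u -> x != v ->
  x \in toll_interval u v ->
  ((x, h) : lexprod G H) \in
    toll_interval ((u, h1) : lexprod G H) ((v, h2) : lexprod G H).
Proof.
move=> xu xv /toll_interval_elim[xE|xE|[uv uNv cv cu]].
- by rewrite xE eqxx in xu.
- by rewrite xE eqxx in xv.
(* All inner vertices get the second coordinate h.  After its start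
   the path in G does not meet c, as the vertex after c would be a neighbour
   of c. *)
have lift (c d y : G) k l : d != c -> ~~ (c -- d) -> y != d ->
    connect (avoid c) y d ->
    connect (@avoid (lexprod G H) (c, k)) (y, h) (d, l).
  move=> dc cNd + /connectP[p]; elim: p y => [|z p IHp] y /=.
    by move=> /[swap] _ /[swap] ->; rewrite eqxx.
  move=> yd /andP[/andP[yz cNz] zp] dE.
  have [zd|zd] := eqVneq z d.
    apply: connect1; rewrite /avoid !lexE /= -zd yz /= negb_or cNz.
    by rewrite eq_sym zd (negPf dc).
  apply: connect_trans (connect1 _) (IHp _ zd zp dE).
  rewrite /avoid !lexE /= yz negb_or cNz /=.
  case: p zp dE {IHp} => [_ dz|z2 p /= /andP[/andP[zz2 cNz2] _] _].
    by rewrite dz eqxx in zd.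
  by case: eqP cNz2 => // ->; rewrite zz2.
apply: toll_interval_intro.
- by apply: contraNneq uv => -[->].
- by rewrite lexE /= (negPf uv) orbF.
- by apply: contraNneq xu => -[->].
- by apply: contraNneq xv => -[->].
- by apply: lift; rewrite // eq_sym.
- by apply: lift; rewrite // sedge_sym.
Qed.

Lemma lex_interval_nbr (x g : G) (h y1 y2 : H) :
  x -- g -> y1 != y2 -> ~~ (y1 -- y2) ->
  ((g, h) : lexprod G H) \in
    toll_interval ((x, y1) : lexprod G H) ((x, y2) : lexprod G H).
Proof.
move=> xg y12 yN; have gx := xg; rewrite sedge_sym in gx.
have yN' : ~~ (y2 -- y1) by rewrite sedge_sym.
apply: toll_interval_intro.
- by apply: contraNneq y12 => -[->].
- by rewrite lexE /= sedge_irrefl eqxx.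
- by apply: contraTneq xg => -[-> _]; rewrite sedge_irrefl.
- by apply: contraTneq xg => -[-> _]; rewrite sedge_irrefl.
- by apply: connect1; rewrite /avoid !lexE /= gx sedge_irrefl eqxx.
- by apply: connect1; rewrite /avoid !lexE /= gx sedge_irrefl eqxx.
Qed.

(** From the layer of [a], every step avoids the neighbouring layers, hence stays
in the layer of [a]; so a path that ends elsewhere never meets that layer. *)
Lemma lex_avoid_far a b t : a.1 != b.1 -> connect (avoid a) t b ->
  t.1 != a.1 /\ connect (avoid a.1) t.1 b.1.
Proof.
move=> ab /connectP[p]; elim: p t => [|z p IHp] t /=.
  by move=> _ <-; rewrite eq_sym.
move=> /andP[/andP[tz aNz] zp] bE; have [za cz] := IHp _ zp bE.
move: aNz; rewrite lexE negb_or => /andP[aNz _].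
split.
  apply: contraNneq za => ta; move: tz; rewrite lexE ta (negPf aNz) /=.
  by case/andP=> /eqP->.
move: tz; rewrite lexE => /orP[tz|/andP[/eqP-> _] //].
by apply: connect_trans cz; apply: connect1; rewrite /avoid tz.
Qed.

(** A path that ends in the layer of [a] and avoids the neighbouring layers can
only leave them by its first step. *)
Lemma lex_avoid_near a b t : a.1 = b.1 -> connect (avoid a) t b ->
  if t.1 == a.1 then connect (avoid a.2) t.2 b.2 else a.1 -- t.1.
Proof.
move=> ab /connectP[p]; elim: p t => [|z p IHp] t /=.
  by move=> _ <-; rewrite ab eqxx connect0.
move=> /andP[/andP[tz aNz] zp] bE; have := IHp _ zp bE.
move: aNz; rewrite lexE negb_or [a.1 == _]eq_sym => /andP[aNz].
case: eqP => [za|_ _ az]; last by rewrite az in aNz.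
move=> /= a2Nz cz; move: tz; rewrite lexE za.
case: eqP => [->|_].
  rewrite sedge_irrefl /= => tz.
  by apply: connect_trans cz; apply: connect1; rewrite /avoid tz.
by rewrite orbF sedge_sym.
Qed.

Lemma lex_interval_far a b t : a.1 != b.1 -> t \in toll_interval a b ->
  [\/ t = a, t = b |
   [/\ ~~ (a.1 -- b.1), t.1 != a.1, t.1 != b.1 &
       t.1 \in toll_interval a.1 b.1]].
Proof.
move=> ab /toll_interval_elim[->|->|[_ aNb cb ca]].
- by constructor 1.
- by constructor 2.
have ba : b.1 != a.1 by rewrite eq_sym.
have [ta tb'] := lex_avoid_far ab cb; have [tb ta'] := lex_avoid_far ba ca.
move: aNb; rewrite lexE negb_or => /andP[aNb _].
constructor 3; split=> //; exact: toll_interval_intro.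
Qed.

Lemma lex_interval_near a b t : a.1 = b.1 -> t \in toll_interval a b ->
  [\/ t = a, t = b,
      t.1 = a.1 /\ t.2 \in toll_interval a.2 b.2 |
   [/\ a.2 != b.2, ~~ (a.2 -- b.2) & a.1 -- t.1]].
Proof.
move=> ab; have [->|ta] := eqVneq t a; first by constructor 1.
have [->|tb] := eqVneq t b; first by constructor 2.
case/toll_interval_elim=> [tE|tE|[anb aNb cb ca]].
- by rewrite tE eqxx in ta.
- by rewrite tE eqxx in tb.
have neq2 (c d : lexprod G H) : c.1 = d.1 -> c != d -> c.2 != d.2.
  move=> cd; apply: contraNneq; case: c d cd => [c1 c2] [d1 d2] /= -> -> //.
have a2b := neq2 _ _ ab anb.
have a2Nb : ~~ (a.2 -- b.2).
  by move: aNb; rewrite lexE ab eqxx negb_or => /andP[].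
have := lex_avoid_near ab cb; have := lex_avoid_near (esym ab) ca.
rewrite -ab; case: eqP => [t1 c1 c2|_ _ at_]; last by constructor 4.
constructor 3; split=> //; apply: toll_interval_intro=> //.
  exact: neq2.
by apply: neq2; rewrite // -ab.
Qed.

Definition fiber (S : {set lexprod G H}) (g : G) : {set H} :=
  [set h | (g, h) \in S].

Lemma card_fibers (S : {set lexprod G H}) : \sum_g #|fiber S g| = #|S|.
Proof.
rewrite -sum1_card (partition_big (fun t : lexprod G H => t.1) xpredT) //=.
apply: eq_bigr => g _; rewrite sum1dep_card.
rewrite -(card_imset (fiber S g) (f := fun h => (g, h) : lexprod G H));
  last by move=> ? ? [].
apply: eq_card => -[g' h]; rewrite inE /=; apply/imsetP/andP.
  by case=> k; rewrite inE => kS [-> ->].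
by case=> gS /eqP gg; exists h; rewrite ?inE ?gg // -gg.
Qed.

(** If the fiber over g is not a toll set of H, some vertex of the layer of g is
covered neither as an end nor from within the layer; the pair that covers it
provides one of the other two alternatives.  The second one forgets that the
two vertices over x are not adjacent: their number is enough to conclude. *)
Lemma toll_set_layer (S : {set lexprod G H}) g : toll_set S ->
  [\/ toll_set (fiber S g), exists2 x : G, x -- g & 1 < #|fiber S x| |
   exists x y : G, [/\ 0 < #|fiber S x|, 0 < #|fiber S y|, x != g, y != g &
     [/\ x != y, ~~ (x -- y) & g \in toll_interval x y]]].
Proof.
move=> /toll_setP cov.
case: (boolP (toll_set _)) => [gT|gNT]; [by constructor 1|].
have [h hN] : exists h, forall y z, y \in fiber S g -> z \in fiber S g ->
    h \notin toll_interval y z.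
  apply: contrapT => noh; case/negP: gNT; apply/toll_setP=> h.
  apply: contrapT => noyz; case: noh; exists h => y z yS zS.
  by apply/negP=> hyz; case: noyz; exists y, z.
have hS : (g, h) \notin S.
  apply/negP=> hS; have hF : h \in fiber S g by rewrite inE.
  by have := hN _ _ hF hF; rewrite toll_interval_refl.
have [[x y] [[x' y'] [aS bS]]] := cov (g, h).
have [xx'|xx'] := eqVneq x x'.
  subst x'; move=> tT.
  case: (lex_interval_near _ tT) => [//|tE|tE|[/= gx hyy']|[/= yy' _ xg]].
  - by rewrite tE aS in hS.
  - by rewrite tE bS in hS.
  - subst g; have yS : y \in fiber S x by rewrite inE.
    have yS' : y' \in fiber S x by rewrite inE.
    by case/negP: (hN _ _ yS yS').
  - by constructor 2; exists x => //; apply/card_gt1P; exists y, y'; rewrite !inE.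
case/lex_interval_far=> [//|tE|tE|[/= xNx' gx gx' gT]].
- by rewrite tE aS in hS.
- by rewrite tE bS in hS.
constructor 3; exists x, x'; rewrite ![_ == g]eq_sym; split=> //.
  by apply/card_gt0P; exists y; rewrite inE.
by apply/card_gt0P; exists y'; rewrite inE.
Qed.
End LexIntervals.

(** * Weights that dominate a graph with two extreme vertices *)

Section Weights.
Variables (G : sgraph) (f : G -> nat).
Implicit Types (g u v x y : G).

(** What a toll set of the product leaves at g once H is forgotten, where f counts
its vertices in each layer and a toll set of H has at least 3 elements. *)
Definition dominated g :=
  [\/ 2 < f g, exists2 x, x -- g & 1 < f x |
   exists x y, [/\ 0 < f x, 0 < f y, x != g, y != g &
     [/\ x != y, ~~ (x -- y) & g \in toll_interval x y]]].

Lemma leq_sum_uniq s : uniq s -> \sum_(i <- s) f i <= \sum_i f i.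
Proof.
by move=> Us; rewrite [leqRHS](bigID (mem s)) /= -big_uniq //= leq_addr.
Qed.

Lemma leq_sum2 x y : x != y -> f x + f y <= \sum_i f i.
Proof.
move=> xy; have := @leq_sum_uniq [:: x; y].
by rewrite !big_cons big_nil addn0 /= inE xy; apply.
Qed.

Lemma leq_sum3 x y z :
  x != y -> x != z -> y != z -> f x + f y + f z <= \sum_i f i.
Proof.
move=> xy xz yz; have := @leq_sum_uniq [:: x; y; z].
by rewrite !big_cons big_nil addn0 addnA /= !inE negb_or xy xz yz; apply.
Qed.

(** Below total weight 6, x has weight 2 and everything else lies in v, so
nothing dominates x. *)
Lemma weight_nbr_and_end v x : x != v -> ~~ (x -- v) -> dominated x ->
  1 < f x -> 2 < f v -> 5 < \sum_i f i.
Proof.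
move=> xv xNv dx fx fv; rewrite ltnNge; apply/negP => f5.
have fxv := leq_sum2 xv.
have supp a : 0 < f a -> a = x \/ a = v.
  move=> fa; apply: contrapT => /not_orP[/eqP ax /eqP av].
  by have := leq_sum3 ax av xv; lia.
case: dx => [|[a ax /ltnW/supp[] aE]|[a [b [/supp[] aE /supp[] bE ax bx [ab _ _]]]]].
- lia.
- by rewrite aE sedge_irrefl in ax.
- by rewrite aE sedge_sym (negPf xNv) in ax.
- by rewrite aE eqxx in ax.
- by rewrite aE eqxx in ax.
- by rewrite bE eqxx in bx.
- by rewrite aE bE eqxx in ab.
Qed.

(** When x and x' carry all the weight, p is one of them; this spares a separate
treatment of four-point toll sets. *)
Lemma third_support x x' : x != x' -> 1 < f x -> 1 < f x' -> \sum_i f i < 6 ->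
  exists p, forall a, 0 < f a -> [\/ a = x, a = x' | a = p].
Proof.
move=> xx' fx fx' f5.
case: (pselect (exists p, [/\ p != x, p != x' & 0 < f p])); last first.
  move=> nop; exists x => a fa; have [->|ax] := eqVneq a x; first by constructor 1.
  by have [->|ax'] := eqVneq a x'; [constructor 2 | case: nop; exists a].
case=> p [px px' fp]; exists p => a fa.
have [->|ax] := eqVneq a x; first by constructor 1.
have [->|ax'] := eqVneq a x'; first by constructor 2.
have [->|ap] := eqVneq a p; first by constructor 3.
have := @leq_sum_uniq [:: a; p; x; x'].
by rewrite /= !inE !negb_or ap ax ax' px px' xx' !big_cons big_nil => /(_ isT); lia.
Qed.

(** A neighbour of weight 2 would have to be p, which is too much weight; so
unless x has weight 3, the pair that dominates x consists of p and x'. *)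
Lemma dominated_by_third x x' p : x != x' -> ~~ (x -- x') ->
  (forall a, 0 < f a -> [\/ a = x, a = x' | a = p]) ->
  dominated x -> 1 < f x -> 1 < f x' -> \sum_i f i < 6 ->
  2 < f x \/
  [/\ p != x, p != x', 0 < f p, ~~ (x' -- p) & x \in toll_interval p x'].
Proof.
move=> xx' xNx' supp dx fx fx' f5; case: dx => [|[a ax fa]|]; first by left.
  case/ltnW/supp: (fa) => aE; move: ax fa; rewrite aE.
  - by rewrite sedge_irrefl.
  - by rewrite sedge_sym (negPf xNx').
  have [->|px'] := eqVneq p x'; first by rewrite sedge_sym (negPf xNx').
  by move=> px fp; have := leq_sum3 (sedge_neq px) px' xx'; lia.
case=> a [b [fa fb ax bx [ab aNb xab]]]; right.
case: (supp _ fa) (supp _ fb) ab aNb xab => aE [] bE;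
  move: fa fb ax bx; rewrite {}aE {}bE ?eqxx //.
  move=> _ fp _ px x'p x'Np xT; split=> //; first by rewrite eq_sym.
  by apply: toll_interval_sym; rewrite // eq_sym.
by move=> fp _ px _ px' pNx' xT; split=> //; rewrite sedge_sym.
Qed.

(** If both x and x' are dominated through p, then x is at the same time inside
the toll interval of p and x' and not adjacent to p, which the extremality of
its neighbour u excludes; weight 3 in x or x' leaves none for p. *)
Lemma weight_nbr_nbr u x x' :
  u \in extreme_vertices G -> u -- x -> x != x' -> ~~ (x -- x') ->
  dominated x -> dominated x' -> 1 < f x -> 1 < f x' -> 5 < \sum_i f i.
Proof.
move=> uE ux xx' xNx' dx dx' fx fx'; rewrite ltnNge; apply/negP => f5.
have [p supp] := third_support xx' fx fx' f5.
have x'x : x' != x by rewrite eq_sym.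
have x'Nx : ~~ (x' -- x) by rewrite sedge_sym.
have supp' a : 0 < f a -> [\/ a = x', a = x | a = p].
  by case/supp; [constructor 2 | constructor 1 | constructor 3].
have [fx3|[px px' fp x'Np xT]] := dominated_by_third xx' xNx' supp dx fx fx' f5;
have [fx3'|[px2 px2' fp2 xNp xT']] := dominated_by_third x'x x'Nx supp' dx' fx' fx f5.
- by have := leq_sum2 xx'; lia.
- by have := leq_sum3 px2' px2 xx'; lia.
- by have := leq_sum3 px px' xx'; lia.
have xp : x != p by rewrite eq_sym.
by case/negP: (extreme_nbr_interval uE ux xNp xp xNx' xx').
Qed.

(** Outside N(x) and N(x') a vertex can only be dominated by a pair made of p and
one of x, x', hence differs from p.  So p lies in N(x) or N(x'), and the
hypothesis for z = p contradicts this domination. *)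
Lemma weight_adjacent_nbrs x x' :
  x -- x' -> (forall g, dominated g) -> 1 < f x -> 1 < f x' ->
  (forall z, z \in nbhd x :|: nbhd x' ->
     exists g, g \notin nbhd x :|: nbhd x' /\
       g \notin toll_interval x z :|: toll_interval x' z) ->
  5 < \sum_i f i.
Proof.
move=> xEx' dom fx fx' far; rewrite ltnNge; apply/negP => f5.
have xx' := sedge_neq xEx'.
have [p supp] := third_support xx' fx fx' f5.
have x'Ex : x' -- x by rewrite sedge_sym.
have inN g : (g \in nbhd x :|: nbhd x') = (x -- g) || (x' -- g).
  by rewrite !inE.
have fp_le1 : p != x -> p != x' -> f p < 2.
  by move=> px px'; have := leq_sum3 px px' xx'; lia.
have outside g : g \notin nbhd x :|: nbhd x' ->
    g != p /\ g \in toll_interval x p :|: toll_interval x' p.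
  rewrite inN negb_or => /andP[xNg x'Ng].
  have gx : g != x by apply: contraNneq x'Ng => ->.
  have gx' : g != x' by apply: contraNneq xNg => ->.
  case: (dom g) => [fg|[a ag fa]|[a [b [fa fb ag bg [ab aNb gab]]]]].
  - case: (supp g) gx gx' => [|->|->|gp]; rewrite ?eqxx //; first by lia.
    by rewrite gp => px px'; have := fp_le1 px px'; rewrite -gp; lia.
  - case: (supp a) ag => [|->|->|ap]; rewrite ?(negPf xNg) ?(negPf x'Ng) //; first by lia.
    have [->|ax] := eqVneq a x; first by rewrite (negPf xNg).
    have [->|ax'] := eqVneq a x'; first by rewrite (negPf x'Ng).
    by move: ax ax' fa; rewrite ap leqNgt => px px'; rewrite fp_le1.
  - have gp c : c = p -> c != g -> g != p by move=> <-; rewrite eq_sym.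
    move: gab; rewrite in_setU.
    case: (supp _ fa) (supp _ fb) ab aNb ag bg => aE [] bE;
      rewrite aE bE ?eqxx ?xEx' ?x'Ex //.
    + by rewrite [p == g]eq_sym => _ _ _ -> ->.
    + by rewrite [p == g]eq_sym => _ _ _ -> ->; rewrite orbT.
    + rewrite [p == g]eq_sym => _ _ gp' _ /(toll_interval_sym gp' gx) ->.
      by rewrite gp'.
    + rewrite [p == g]eq_sym => _ _ gp' _ /(toll_interval_sym gp' gx') ->.
      by rewrite gp' orbT.
have pN : p \in nbhd x :|: nbhd x'.
  by apply: contraT => /outside[]; rewrite eqxx.
have [g [gN gT]] := far p pN.
have [_ gT'] := outside g gN.
by rewrite gT' in gT.
Qed.

(** The third way of being dominated is impossible at u and v, so each of them,
or one of its neighbours, carries at least 2. *)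
Lemma dominating_weight u v :
  u \in extreme_vertices G -> v \in extreme_vertices G -> u != v -> 2 < gdist u v ->
  (gdist u v = 3 ->
     forall u' v' : G, u' -- v' -> u' \in nbhd u -> v' \in nbhd v ->
     forall z : G, z \in nbhd u' :|: nbhd v' ->
     exists x : G, x \notin nbhd u' :|: nbhd v' /\
       x \notin toll_interval u' z :|: toll_interval v' z) ->
  (forall g, dominated g) -> 5 < \sum_i f i.
Proof.
move=> uE vE uv d3 far dom.
have dle p : path (@sedge G) u p -> last u p = v -> 2 < size p.
  by move=> up lp; apply: leq_trans d3 _; rewrite -lp; exact: gdist_le.
have uNv : ~~ (u -- v).
  by apply/negP => e; have := dle [:: v]; rewrite /= e => /(_ isT erefl).
have nocommon x : u -- x -> ~~ (x -- v).
  move=> ux; apply/negP => xv.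
  by have := dle [:: x; v]; rewrite /= ux xv => /(_ isT erefl).
have end_or_nbr s : s \in extreme_vertices G -> 2 < f s \/ exists2 x, s -- x & 1 < f x.
  move=> sE; case: (dom s) => [|[x xs fx]|[a [b [_ _ sa sb [_ _ sT]]]]].
  - by left.
  - by right; exists x; rewrite // sedge_sym.
  - by case/negP: (extremeP sE sa sb).
have [fu|[x ux fx]] := end_or_nbr u uE; have [fv|[x' vx' fx']] := end_or_nbr v vE.
- exact: leq_trans (leq_add fu fv) (leq_sum2 uv).
- apply: (weight_nbr_and_end _ _ (dom x') fx' fu).
    by apply: contraNneq uNv => <-; rewrite sedge_sym.
  apply/negP => x'u.
  by have := nocommon x'; rewrite sedge_sym x'u sedge_sym vx' => /(_ isT).
- apply: (weight_nbr_and_end _ _ (dom x) fx fv); last exact: nocommon.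
  by apply: contraNneq uNv => <-.
have xx' : x != x'.
  by apply: contraTneq vx' => <-; rewrite sedge_sym nocommon.
case: (boolP (x -- x')) => [xEx'|xNx']; last first.
  exact: (weight_nbr_nbr uE ux xx' xNx' (dom x) (dom x') fx fx').
apply: (weight_adjacent_nbrs xEx' dom fx fx'); apply: far; rewrite ?inE //.
apply/eqP; rewrite eqn_leq d3 andbT.
by apply: (@gdist_le _ u [:: x; x'; v]); rewrite /= ux xEx' sedge_sym vx'.
Qed.
End Weights.

(** * The toll number of the product *)

Lemma lex_toll_number_ge6 (G H : sgraph) (u v : G) :
  u \in extreme_vertices G -> v \in extreme_vertices G -> u != v -> 2 < gdist u v ->
  (gdist u v = 3 ->
     forall u' v' : G, u' -- v' -> u' \in nbhd u -> v' \in nbhd v ->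
     forall z : G, z \in nbhd u' :|: nbhd v' ->
     exists x : G, x \notin nbhd u' :|: nbhd v' /\
       x \notin toll_interval u' z :|: toll_interval v' z) ->
  2 < toll_number H -> 5 < toll_number (lexprod G H).
Proof.
move=> uE vE uv d3 far tH; have [S [ST <-]] := toll_number_attained (lexprod G H).
rewrite -card_fibers; apply: (dominating_weight uE vE uv d3 far) => g.
case: (toll_set_layer g ST) => [/toll_number_le gT|?|?].
- by constructor 1; exact: leq_trans tH gT.
- by constructor 2.
- by constructor 3.
Qed.

Lemma lex_toll_set6 (G H : sgraph) (u v u' v' : G) (h y1 y2 : H) :
  (forall x, x != u -> x != v -> x \in toll_interval u v) ->
  u -- u' -> v -- v' ->
  y1 != y2 -> ~~ (y1 -- y2) ->
  toll_set [set t : lexprod G H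
           | t \in [:: (u, h); (v, h); (u', y1); (u', y2); (v', y1); (v', y2)]].
Proof.
move=> uvT uu' vv' y12 yN; apply/toll_setP=> -[g k].
have [->|gu] := eqVneq g u.
  exists (u', y1), (u', y2); split; [by rewrite !inE eqxx ?orbT..|].
  by apply: lex_interval_nbr; rewrite // sedge_sym.
have [->|gv] := eqVneq g v.
  exists (v', y1), (v', y2); split; [by rewrite !inE eqxx ?orbT..|].
  by apply: lex_interval_nbr; rewrite // sedge_sym.
exists (u, h), (v, h); split; [by rewrite !inE eqxx ?orbT..|].
by apply: lex_interval_lift => //; exact: uvT.
Qed.

Theorem lemma4p16 (G H : sgraph) (u v : G)
  (connG : connected G) (connH : connected H)
  (ntG : nontrivial G) (ntH : nontrivial H)
  (HnK : ~ complete H) (GnK2 : ~ isomorphic G (K 2))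
  (tnG : toll_number G = 2) (cardExtG : #|extreme_vertices G| = 2)
  (ExtG : extreme_vertices G = [set u; v])
  (tnH : 2 < toll_number H)
  (nbhdG : forall x y : G, nbhd x :|: nbhd y <> [set: G])
  (dist_ge3 : 3 <= gdist u v)
  (dist_eq3 : gdist u v = 3 ->
     forall u' v' : G, u' -- v' -> u' \in nbhd u -> v' \in nbhd v ->
     forall z : G, z \in nbhd u' :|: nbhd v' ->
     exists x : G, x \notin nbhd u' :|: nbhd v' /\
       x \notin toll_interval u' z :|: toll_interval v' z) :
  toll_number (lexprod G H) = 3 * toll_number G.
Proof.
have uE : u \in extreme_vertices G by rewrite ExtG !inE eqxx.
have vE : v \in extreme_vertices G by rewrite ExtG !inE eqxx orbT.
have uv : u != v.
  by apply/eqP => uv; move: cardExtG; rewrite ExtG uv setUid cards1.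
have nbr (a b : G) : a != b -> exists a', a -- a'.
  case/connectP: (connG a b) => -[|a' p] /=; first by move=> _ ->; rewrite eqxx.
  by case/andP=> aa' _ _ _; exists a'.
have [u' uu'] := nbr u v uv.
have [v' vv'] : exists v', v -- v' by apply: (nbr v u); rewrite eq_sym.
have [y1 [y2 [y12 yN]]] : exists y1 y2 : H, y1 != y2 /\ ~~ (y1 -- y2).
  apply: contrapT => noy; apply: HnK => y1 y2 y12; apply: contraT => yN.
  by case: noy; exists y1, y2.
have uvT x : x != u -> x != v -> x \in toll_interval u v.
  move=> xu xv; have [S [ST S2]] := toll_number_attained G.
  (* A minimum toll set contains both extreme vertices, and has size 2. *)
  have SE : [set u; v] = S.
    apply/eqP; rewrite eqEcard S2 tnG cards2 uv andbT subUset !sub1set.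
    by apply/andP; split; exact: extreme_mem_toll_set.
  have /toll_setP/(_ x) := ST; rewrite -SE => -[a [b [aS bS]]].
  have self (c : G) : c != x -> x \in toll_interval c c -> x \in toll_interval u v.
    by move=> cx /toll_interval_elim[xc|xc|[]]; rewrite ?xc eqxx // in cx *.
  case/set2P: aS => ->; case/set2P: bS => -> //.
  - by apply: self; rewrite eq_sym.
  - exact: toll_interval_sym.
  - by apply: self; rewrite eq_sym.
apply/eqP; rewrite tnG eqn_leq (lex_toll_number_ge6 uE vE uv dist_ge3 dist_eq3 tnH) andbT.
apply: leq_trans (toll_number_le (lex_toll_set6 y1 uvT uu' vv' y12 yN)) _.
by rewrite cardsE; apply: leq_trans (card_size _) _.
Qed.
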